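(* Let $M$ be the weighted integral mean of the first kind with integrality function $t\mapsto\frac{1}{\sqrt t}$ and symmetric distribution function $t\mapsto\frac{1}{\pi\sqrt{t(1-t)}}$, that is, with $f(t)=\frac{1}{\sqrt t}$ for $t>0$, $$M(x,y)=f^{-1}\left(\int_0^1 f\left(tx+(1-t)y\right)\frac{dt}{\pi\sqrt{t(1-t)}}\right)\quad(\forall x,y>0).$$ Then the arithmetic-geometric mean $\mathrm{AGM}$ is an $M$-mean. More precisely, setting $h(t)=t^2$ for $t>0$, we have $$\mathrm{AGM}=h^{-1}\circ M\circ h,$$ i.e. $\mathrm{AGM}(x,y)=h^{-1}\left(M(h(x),h(y))\right)$ for all $x,y>0$.
   Context: A mean is a function $M:(0,+\infty)^2\to(0,+\infty)$ of class $C^\infty$ such that $\min(x,y)\le M(x,y)\le\max(x,y)$ and $M(x,y)=M(y,x)$ for all $x,y>0$. Given a mean $M$, an $M$-mean is any function $F:(0,+\infty)^2\to(0,+\infty)$ of the form $F=f^{-1}\circ M\circ f$, i.e. $F(x,y)=f^{-1}(M(f(x),f(y)))$, where $f:(0,+\infty)\to(0,+\infty)$ is strictly monotonic and infinitely differentiable. For $x,y>0$, $\mathrm{AGM}(x,y)$ is the common limit of the sequences $(x_n)_{n\ge0}$, $(y_n)_{n\ge0}$ defined by $x_0=x$, $y_0=y$, $x_{n+1}=\frac{x_n+y_n}{2}$, $y_{n+1}=\sqrt{x_ny_n}$. *)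

(* Defs.v *)
(* Functions on (0,+oo) and (0,+oo)^2 are total
   functions on R and R x R, of which only the values at positive arguments matter. *)
From Stdlib Require Import Reals ClassicalEpsilon.
From Coquelicot Require Import Coquelicot.
Open Scope R_scope.

(* The inverse, on its image, of the restriction to (0,+oo) of an injective [f];
   unspecified outside that image. *)
Definition pos_inv (f : R -> R) (z : R) : R :=
  epsilon (inhabits 1) (fun t => 0 < t /\ f t = z).

(* f^{-1} o M o f *)
Definition conj_by (f : R -> R) (M : R -> R -> R) (x y : R) : R :=
  pos_inv f (M (f x) (f y)).

Definition pos_smooth (f : R -> R) : Prop :=
  forall (n : nat) (x : R), 0 < x -> ex_derive_n f n x.

Definition pos_strictly_monotonic (f : R -> R) : Prop :=
  (forall x y, 0 < x -> x < y -> f x < f y) \/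
  (forall x y, 0 < x -> x < y -> f y < f x).

(* Class C^n on (0,+oo)^2: all partial derivatives of order n exist and are continuous. *)
Fixpoint pos_Cn_2d (n : nat) (F : R -> R -> R) : Prop :=
  match n with
  | O => forall x y, 0 < x -> 0 < y -> continuity_2d_pt F x y
  | S n =>
      (forall x y, 0 < x -> 0 < y ->
         ex_derive (fun u => F u y) x /\ ex_derive (fun v => F x v) y) /\
      pos_Cn_2d n (fun x y => Derive (fun u => F u y) x) /\
      pos_Cn_2d n (fun x y => Derive (fun v => F x v) y)
  end.

Definition pos_smooth_2d (F : R -> R -> R) : Prop := forall n, pos_Cn_2d n F.

(* Positivity of [M x y] is implied by the lower bound [Rmin x y]. *)
Definition is_mean (M : R -> R -> R) : Prop :=
  pos_smooth_2d M /\
  (forall x y, 0 < x -> 0 < y -> Rmin x y <= M x y <= Rmax x y) /\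
  (forall x y, 0 < x -> 0 < y -> M x y = M y x).

(* When [M] is a mean, [M (f x) (f y)] lies between [f x] and [f y], hence in the image
   of the continuous function [f], so that [pos_inv f] is meaningful there. *)
Definition is_M_mean (M F : R -> R -> R) : Prop :=
  is_mean M /\
  exists f : R -> R,
    (forall x, 0 < x -> 0 < f x) /\
    pos_strictly_monotonic f /\
    pos_smooth f /\
    (forall x y, 0 < x -> 0 < y -> F x y = conj_by f M x y).

(* The integral over (0,1) is improper at both ends. *)
Definition weighted_integral_mean (f p : R -> R) (x y : R) : R :=
  pos_inv f (RInt_gen (fun t => f (t * x + (1 - t) * y) * p t)
                      (at_right 0) (at_left 1)).

Fixpoint agm_seq (x y : R) (n : nat) : R * R :=
  match n with
  | O => (x, y)
  | S n => let (a, b) := agm_seq x y n in ((a + b) / 2, sqrt (a * b))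
  end.

Definition AGM (x y : R) : R :=
  epsilon (inhabits 1)
    (fun l : R => is_lim_seq (fun n => fst (agm_seq x y n)) l /\
                  is_lim_seq (fun n => snd (agm_seq x y n)) l).

(* Main.v *)
Require Import Defs.
From Stdlib Require Import Reals Lra Lia ClassicalEpsilon.
From Coquelicot Require Import Coquelicot.
Open Scope R_scope.

(** The substitution [t = sin^2 u] turns the arcsine weight [dt / (PI sqrt (t (1 - t)))]
    into [(2 / PI) du] on [(0, PI/2)], so that the integral defining [M x y] is
    [(2 / PI) G(x, y)], where [G(x, y)] is the complete elliptic integral [gauss x y] of
    [1 / sqrt (x sin^2 u + y cos^2 u)], and [M x y = (PI / (2 G(x, y)))^2]
    ([arcsine_mean_gauss]).

    That [AGM] is conjugate to [M] by squaring is then Gauss's theorem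
    [AGM x y = PI / (2 G(x^2, y^2))].  The map [(a, b) |-> G(a^2, b^2)] is unchanged by one
    step of the AGM iteration ([gauss_landen]), which follows from the change of variable
    [landen]: it doubles the interval [(0, PI/2)], and reflection halves it back.  As the
    integrand lies between [1 / max(a, b)] and [1 / min(a, b)], the number
    [PI / (2 G(a^2, b^2))] lies between [a] and [b].  It is the same number [l] at every step
    of the iteration, while the gap between the two sequences is at least halved each time,
    so both sequences converge to [l].  The limit is thus found at the same time as it is
    shown to exist.

    The same bounds, and the symmetry of [G], give two of the three properties of a mean.
    Smoothness of [M] comes from differentiation under the integral sign: the functions
    built by sums, products, inverses and constants from the integrals
    [elliptic w n x y], of [w u / (sqrt (x sin^2 u + y cos^2 u))^n] with [w >= 0] continuous,
    are continuous on the quadrant and form a class stable under both partial derivatives,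
    so each of them is of class C^n for all n ([pos_smooth_2d_of_closed]). *)

(** * Elliptic integrals and their partial derivatives *)

Definition quad (x y t : R) : R := x * sin t ^ 2 + y * cos t ^ 2.

Lemma sin2_plus_cos2 t : sin t ^ 2 + cos t ^ 2 = 1.
Proof. generalize (sin2_cos2 t). unfold Rsqr. lra. Qed.

Lemma quad_bounds x y t : Rmin x y <= quad x y t <= Rmax x y.
Proof.
  unfold quad. generalize (sin2_plus_cos2 t) (pow2_ge_0 (sin t)) (pow2_ge_0 (cos t))
    (Rmin_l x y) (Rmin_r x y) (Rmax_l x y) (Rmax_r x y).
  generalize (sin t ^ 2) (cos t ^ 2) (Rmin x y) (Rmax x y).
  intros s c m M Hsc Hs Hc H1 H2 H3 H4. replace c with (1 - s) in * by lra. nra.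
Qed.

Lemma quad_pos x y t : 0 < x -> 0 < y -> 0 < quad x y t.
Proof.
  intros Hx Hy. apply Rlt_le_trans with (Rmin x y).
  - now apply Rmin_pos.
  - apply quad_bounds.
Qed.

Lemma quad_le x y x' y' t : x <= x' -> y <= y' -> quad x y t <= quad x' y' t.
Proof.
  intros. unfold quad. apply Rplus_le_compat; apply Rmult_le_compat_r; auto; apply pow2_ge_0.
Qed.

Lemma quad_scal l x y t : quad (l * x) (l * y) t = l * quad x y t.
Proof. unfold quad. ring. Qed.

Lemma continuous_sin2 t : continuous (fun t => sin t ^ 2) t.
Proof.
  apply (ex_derive_continuous (K := R_AbsRing) (V := R_NormedModule)).
  auto_derive. trivial.
Qed.

Lemma continuous_cos2 t : continuous (fun t => cos t ^ 2) t.
Proof.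
  apply (ex_derive_continuous (K := R_AbsRing) (V := R_NormedModule)).
  auto_derive. trivial.
Qed.

Lemma continuous_quad x y t : continuous (quad x y) t.
Proof.
  apply (ex_derive_continuous (K := R_AbsRing) (V := R_NormedModule)).
  unfold quad. auto_derive. trivial.
Qed.

Lemma continuous_inv_sqrt_pow n u : 0 < u -> continuous (fun u => (/ sqrt u) ^ n) u.
Proof.
  intros Hu. apply (ex_derive_continuous (K := R_AbsRing) (V := R_NormedModule)).
  assert (0 < sqrt u) by now apply sqrt_lt_R0.
  apply (ex_derive_pow (fun u => / sqrt u)). auto_derive. repeat split; auto. lra.
Qed.

Lemma is_derive_inv_sqrt_pow n u :
  0 < u ->
  is_derive (fun u => (/ sqrt u) ^ n) u (- (INR n / 2) * (/ sqrt u) ^ (n + 2)).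
Proof.
  intros Hu. assert (Hs : 0 < sqrt u) by now apply sqrt_lt_R0.
  assert (H1 : is_derive (fun u => / sqrt u) u (- / 2 * (/ sqrt u) ^ 3)).
  { auto_derive. repeat split; auto; lra. field. lra. }
  evar_last; [apply (is_derive_pow _ n _ _ H1)|].
  destruct n as [|n]. simpl; lra.
  replace (S n + 2)%nat with (n + 3)%nat by lia. rewrite pow_add. simpl pred. field.
  lra.
Qed.

Definition elliptic (w : R -> R) (n : nat) (x y : R) : R :=
  RInt (fun t => w t * (/ sqrt (quad x y t)) ^ n) 0 (PI / 2).

(** Both partial derivatives of an elliptic integral are instances, [p] and [q] being, up to
    a constant factor, the squares of sine and cosine in either order. *)
Lemma is_derive_RInt_inv_sqrt_pow (w p q : R -> R) (n : nat) (u0 : R) :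
  (forall t, continuous w t) ->
  (forall t, continuous p t) ->
  (forall t, continuous q t) ->
  (forall u t, 0 < u -> 0 < u * p t + q t) ->
  0 < u0 ->
  is_derive (fun u => RInt (fun t => w t * (/ sqrt (u * p t + q t)) ^ n) 0 (PI / 2)) u0
    (- (INR n / 2) *
     RInt (fun t => w t * p t * (/ sqrt (u0 * p t + q t)) ^ (n + 2)) 0 (PI / 2)).
Proof.
  intros Cw Cp Cq Hpos Hu0.
  assert (HD : forall u t, 0 < u ->
    is_derive (fun u => w t * (/ sqrt (u * p t + q t)) ^ n) u
      (- (INR n / 2) * (w t * p t * (/ sqrt (u * p t + q t)) ^ (n + 2)))).
  { intros u t Hu.
    replace (- (INR n / 2) * (w t * p t * (/ sqrt (u * p t + q t)) ^ (n + 2)))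
      with (w t * (p t * (- (INR n / 2) * (/ sqrt (u * p t + q t)) ^ (n + 2)))) by ring.
    apply is_derive_scal.
    apply (is_derive_comp (fun v => (/ sqrt v) ^ n) (fun u => u * p t + q t)).
    - now apply is_derive_inv_sqrt_pow, Hpos.
    - auto_derive; [trivial|ring]. }
  assert (Hloc : locally u0 (fun u => 0 < u)).
  { apply locally_interval with 0 p_infty; simpl; auto. }
  assert (Cpos : forall (g : R -> R) m u, 0 < u -> (forall t, continuous g t) ->
     ex_RInt (fun t => g t * (/ sqrt (u * p t + q t)) ^ m) 0 (PI / 2)).
  { intros g m u Hu Cg. apply (ex_RInt_continuous (V := R_CompleteNormedModule)). intros t _.
    apply (continuous_mult (K := R_AbsRing)); [apply Cg|].
    apply (continuous_comp (fun t => u * p t + q t) (fun v => (/ sqrt v) ^ m)).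
    - apply (continuous_plus (V := R_NormedModule)); [|apply Cq].
      apply (continuous_mult (K := R_AbsRing)); [apply continuous_const|apply Cp].
    - now apply continuous_inv_sqrt_pow, Hpos. }
  rewrite <- (RInt_scal (V := R_CompleteNormedModule)).
  2: { apply (Cpos (fun t => w t * p t)); auto. intros t.
       now apply (continuous_mult (K := R_AbsRing)). }
  erewrite RInt_ext.
  2: { intros t _. symmetry. apply is_derive_unique, (HD u0 t Hu0). }
  apply is_derive_RInt_param.
  - apply filter_imp with (2 := Hloc). intros u Hu t _. eexists. now apply HD.
  - intros t _.
    apply continuity_2d_pt_ext_loc with
      (fun u v => - (INR n / 2) * (w v * p v * (/ sqrt (u * p v + q v)) ^ (n + 2))).
    + exists (mkposreal _ Hu0). simpl. intros u v Hu _. symmetry. apply is_derive_unique, HD.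
      apply Rabs_def2 in Hu. lra.
    + assert (C2 : forall g : R -> R, (forall t, continuous g t) ->
        continuity_2d_pt (fun _ v => g v) u0 t).
      { intros g Cg. apply (continuity_1d_2d_pt_comp g (fun _ v => v)).
        - apply continuity_pt_filterlim, Cg.
        - apply continuity_2d_pt_id2. }
      apply continuity_2d_pt_mult; [apply continuity_2d_pt_const|].
      apply continuity_2d_pt_mult. apply continuity_2d_pt_mult; now apply C2.
      apply (continuity_1d_2d_pt_comp (fun r => (/ sqrt r) ^ (n + 2))
               (fun u v => u * p v + q v)).
      * now apply continuity_pt_filterlim, continuous_inv_sqrt_pow, Hpos.
      * apply continuity_2d_pt_plus; [|now apply C2].
        apply continuity_2d_pt_mult; [apply continuity_2d_pt_id1|now apply C2].
  - apply filter_imp with (2 := Hloc). intros u Hu. now apply Cpos.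
Qed.

Lemma ex_RInt_elliptic w n x y a b :
  (forall t, continuous w t) -> 0 < x -> 0 < y ->
  ex_RInt (fun t => w t * (/ sqrt (quad x y t)) ^ n) a b.
Proof.
  intros Cw Hx Hy. apply (ex_RInt_continuous (V := R_CompleteNormedModule)). intros t _.
  apply (continuous_mult (K := R_AbsRing)); [apply Cw|].
  apply (continuous_comp (quad x y) (fun v => (/ sqrt v) ^ n)).
  - apply continuous_quad.
  - now apply continuous_inv_sqrt_pow, quad_pos.
Qed.

Lemma is_derive_elliptic_l w n x y :
  (forall t, continuous w t) -> 0 < x -> 0 < y ->
  is_derive (fun u => elliptic w n u y) x
    (- (INR n / 2) * elliptic (fun t => w t * sin t ^ 2) (n + 2) x y).
Proof.
  intros Cw Hx Hy.
  apply (is_derive_RInt_inv_sqrt_pow w (fun t => sin t ^ 2) (fun t => y * cos t ^ 2)); auto.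
  - intros t. apply continuous_sin2.
  - intros t. apply (continuous_mult (K := R_AbsRing));
      [apply continuous_const|apply continuous_cos2].
  - intros u t Hu. now apply quad_pos.
Qed.

Lemma is_derive_elliptic_r w n x y :
  (forall t, continuous w t) -> 0 < x -> 0 < y ->
  is_derive (fun v => elliptic w n x v) y
    (- (INR n / 2) * elliptic (fun t => w t * cos t ^ 2) (n + 2) x y).
Proof.
  intros Cw Hx Hy. unfold elliptic, quad.
  rewrite (RInt_ext _ (fun t => w t * cos t ^ 2 *
    (/ sqrt (y * cos t ^ 2 + x * sin t ^ 2)) ^ (n + 2)));
    [|intros; now rewrite Rplus_comm].
  apply is_derive_ext with (fun v =>
    RInt (fun t => w t * (/ sqrt (v * cos t ^ 2 + x * sin t ^ 2)) ^ n) 0 (PI / 2)).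
  { intros v. apply RInt_ext. intros; now rewrite Rplus_comm. }
  apply (is_derive_RInt_inv_sqrt_pow w (fun t => cos t ^ 2) (fun t => x * sin t ^ 2)); auto.
  - intros t. apply continuous_cos2.
  - intros t. apply (continuous_mult (K := R_AbsRing));
      [apply continuous_const|apply continuous_sin2].
  - intros u t Hu. rewrite Rplus_comm. now apply quad_pos.
Qed.

Lemma inv_sqrt_le u v : 0 < u -> u <= v -> / sqrt v <= / sqrt u.
Proof.
  intros Hu Huv. apply Rinv_le_contravar; [now apply sqrt_lt_R0|now apply sqrt_le_1_alt].
Qed.

Lemma inv_sqrt_pos u : 0 < u -> 0 < / sqrt u.
Proof. intros Hu. now apply Rinv_0_lt_compat, sqrt_lt_R0. Qed.

Lemma elliptic_antitone w n x y x' y' :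
  (forall t, continuous w t) -> (forall t, 0 <= w t) ->
  0 < x -> 0 < y -> x <= x' -> y <= y' ->
  elliptic w n x' y' <= elliptic w n x y.
Proof.
  intros Cw Pw Hx Hy Hxx Hyy.
  apply RInt_le; try (apply ex_RInt_elliptic; auto; lra).
  - generalize PI_RGT_0; lra.
  - intros t _. apply Rmult_le_compat_l; [apply Pw|]. apply pow_incr. split.
    + apply Rlt_le, inv_sqrt_pos, quad_pos; lra.
    + apply inv_sqrt_le; [now apply quad_pos|now apply quad_le].
Qed.

(** Homogeneity, together with [elliptic_antitone], replaces any uniform estimate on the
    integrand in the proof of joint continuity. *)
Lemma elliptic_scal w n l x y :
  (forall t, continuous w t) -> 0 < l -> 0 < x -> 0 < y ->
  elliptic w n (l * x) (l * y) = (/ sqrt l) ^ n * elliptic w n x y.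
Proof.
  intros Cw Hl Hx Hy. unfold elliptic.
  rewrite <- (RInt_scal (V := R_CompleteNormedModule)); [|now apply ex_RInt_elliptic].
  apply RInt_ext. intros t _. rewrite quad_scal, sqrt_mult by
    (apply Rlt_le; auto; now apply quad_pos).
  rewrite Rinv_mult, Rpow_mult_distr.
  change scal with Rmult. simpl. ring.
Qed.

(** A point close to [(x, y)] lies between [((1 - d) x, (1 - d) y)] and
    [((1 + d) x, (1 + d) y)].  By monotonicity the value there lies between the values at
    these two points, which homogeneity reduces to a continuous function of one variable. *)
Lemma continuity_2d_pt_elliptic w n x y :
  (forall t, continuous w t) -> (forall t, 0 <= w t) -> 0 < x -> 0 < y ->
  continuity_2d_pt (elliptic w n) x y.
Proof.
  intros Cw Pw Hx Hy.
  assert (C : continuous (fun l => (/ sqrt l) ^ n * elliptic w n x y) 1).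
  { apply (continuous_mult (K := R_AbsRing)); [|apply continuous_const].
    apply continuous_inv_sqrt_pow. lra. }
  intros eps.
  destruct (proj1 (filterlim_locally _ _) C eps) as [delta Hd].
  set (d := Rmin delta 1 / 2).
  assert (H0 : 0 < Rmin delta 1) by (apply Rmin_pos; [apply cond_pos|lra]).
  generalize (Rmin_l delta 1) (Rmin_r delta 1); intros H1 H2.
  assert (Hm : 0 < d * Rmin x y).
  { apply Rmult_lt_0_compat; [unfold d; lra|now apply Rmin_pos]. }
  exists (mkposreal _ Hm). simpl. intros u v Hu Hv.
  assert (Hdx : d * Rmin x y <= d * x).
  { apply Rmult_le_compat_l; [unfold d; lra|apply Rmin_l]. }
  assert (Hdy : d * Rmin x y <= d * y).
  { apply Rmult_le_compat_l; [unfold d; lra|apply Rmin_r]. }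
  apply Rabs_def2 in Hu. apply Rabs_def2 in Hv.
  assert (Hl : forall l, 0 < l -> Rabs (l - 1) < delta ->
    Rabs (elliptic w n (l * x) (l * y) - elliptic w n x y) < eps).
  { intros l Pl Hl. rewrite elliptic_scal by auto.
    generalize (Hd l Hl). unfold ball; simpl; unfold AbsRing_ball, abs, minus, plus, opp; simpl.
    replace ((/ sqrt 1) ^ n) with 1 by (rewrite sqrt_1, Rinv_1, pow1; trivial).
    rewrite Rmult_1_l. trivial. }
  assert (L1 := Hl (1 - d)). assert (L2 := Hl (1 + d)).
  assert (P1 : 0 < 1 - d) by (unfold d; lra). assert (P2 : 0 < 1 + d) by (unfold d; lra).
  specialize (L1 P1). specialize (L2 P2).
  assert (D1 : Rabs (1 - d - 1) < delta).
  { apply Rabs_def1; unfold d; lra. }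
  assert (D2 : Rabs (1 + d - 1) < delta).
  { apply Rabs_def1; unfold d; lra. }
  specialize (L1 D1). specialize (L2 D2).
  apply Rabs_def2 in L1. apply Rabs_def2 in L2.
  assert (Q1 : 0 < (1 - d) * x) by now apply Rmult_lt_0_compat.
  assert (Q2 : 0 < (1 - d) * y) by now apply Rmult_lt_0_compat.
  assert (B1 : elliptic w n u v <= elliptic w n ((1 - d) * x) ((1 - d) * y)).
  { apply elliptic_antitone; auto; lra. }
  assert (B2 : elliptic w n ((1 + d) * x) ((1 + d) * y) <= elliptic w n u v).
  { apply elliptic_antitone; auto; lra. }
  apply Rabs_def1; lra.
Qed.

(** * A class of smooth functions on the quadrant *)

Definition closed_under_partials (C : (R -> R -> R) -> Prop) : Prop :=
  forall F, C F ->
    (forall x y, 0 < x -> 0 < y -> continuity_2d_pt F x y) /\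
    exists F1 F2, C F1 /\ C F2 /\
      forall x y, 0 < x -> 0 < y ->
        is_derive (fun u => F u y) x (F1 x y) /\ is_derive (fun v => F x v) y (F2 x y).

Lemma locally_pos x : 0 < x -> locally x (fun u : R => 0 < u).
Proof. intros Hx. apply locally_interval with 0 p_infty; simpl; auto. Qed.

(** Induction on the order of differentiability; the class replaces any chain rule for
    functions of class C^n.  The equality of [G] and [F] is only required on the quadrant,
    since the partial derivatives of [G] as total functions agree with members of the class
    only there. *)
Lemma pos_smooth_2d_of_closed C F G :
  closed_under_partials C -> C F ->
  (forall x y, 0 < x -> 0 < y -> G x y = F x y) ->
  pos_smooth_2d G.
Proof.
  intros HC HF HG n. revert F G HF HG. induction n as [|n IH]; intros F G HF HG; simpl;
    destruct (HC F HF) as [HF0 (F1 & F2 & C1 & C2 & HD)].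
  - intros x y Hx Hy. apply continuity_2d_pt_ext_loc with F; [|now apply HF0].
    exists (mkposreal _ (Rmin_pos _ _ Hx Hy)). simpl. intros u v Hu Hv. symmetry.
    generalize (Rmin_l x y) (Rmin_r x y); intros H1 H2.
    apply Rabs_def2 in Hu. apply Rabs_def2 in Hv. apply HG; lra.
  - assert (HDG : forall x y, 0 < x -> 0 < y ->
        is_derive (fun u => G u y) x (F1 x y) /\ is_derive (fun v => G x v) y (F2 x y)).
    { intros x y Hx Hy. destruct (HD x y Hx Hy) as [D1 D2]. split.
      - apply is_derive_ext_loc with (2 := D1).
        apply filter_imp with (2 := locally_pos x Hx). intros u Hu. symmetry; now apply HG.
      - apply is_derive_ext_loc with (2 := D2).
        apply filter_imp with (2 := locally_pos y Hy). intros u Hu. symmetry; now apply HG. }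
    split; [|split].
    + intros x y Hx Hy. destruct (HDG x y Hx Hy) as [D1 D2].
      split; eexists; [exact D1|exact D2].
    + apply IH with F1; auto. intros x y Hx Hy. now apply is_derive_unique, HDG.
    + apply IH with F2; auto. intros x y Hx Hy. now apply is_derive_unique, HDG.
Qed.

(** Nonnegative weights keep the integrals monotone, hence continuous; differentiation
    multiplies the weight by a square, which preserves this. *)
Inductive elliptic_expr : (R -> R -> R) -> Prop :=
| expr_elliptic w n :
    (forall t, continuous w t) -> (forall t, 0 <= w t) -> elliptic_expr (elliptic w n)
| expr_const c : elliptic_expr (fun _ _ => c)
| expr_plus F G :
    elliptic_expr F -> elliptic_expr G -> elliptic_expr (fun x y => F x y + G x y)
| expr_mult F G :
    elliptic_expr F -> elliptic_expr G -> elliptic_expr (fun x y => F x y * G x y)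
| expr_inv F :
    (forall x y, 0 < x -> 0 < y -> F x y <> 0) ->
    elliptic_expr F -> elliptic_expr (fun x y => / F x y).

Lemma elliptic_expr_closed : closed_under_partials elliptic_expr.
Proof.
  intros F HF.
  induction HF as [w n Cw Pw|c|F G HF IHF HG IHG|F G HF IHF HG IHG|F NF HF IHF].
  - split.
    + intros x y Hx Hy. now apply continuity_2d_pt_elliptic.
    + exists (fun x y => - (INR n / 2) * elliptic (fun t => w t * sin t ^ 2) (n + 2) x y),
             (fun x y => - (INR n / 2) * elliptic (fun t => w t * cos t ^ 2) (n + 2) x y).
      split; [|split].
      * apply (expr_mult (fun _ _ => - (INR n / 2))); [apply expr_const|].
        apply expr_elliptic.
        -- intros t. apply (continuous_mult (K := R_AbsRing));
             [apply Cw|apply continuous_sin2].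
        -- intros t. apply Rmult_le_pos; [apply Pw|apply pow2_ge_0].
      * apply (expr_mult (fun _ _ => - (INR n / 2))); [apply expr_const|].
        apply expr_elliptic.
        -- intros t. apply (continuous_mult (K := R_AbsRing));
             [apply Cw|apply continuous_cos2].
        -- intros t. apply Rmult_le_pos; [apply Pw|apply pow2_ge_0].
      * intros x y Hx Hy. split; [now apply is_derive_elliptic_l|now apply is_derive_elliptic_r].
  - split.
    + intros. apply continuity_2d_pt_const.
    + exists (fun _ _ => 0), (fun _ _ => 0).
      split; [apply expr_const|split; [apply expr_const|]]. intros x y _ _.
      split; apply (is_derive_const (K := R_AbsRing) (V := R_NormedModule) c).
  - destruct IHF as [CF (F1 & F2 & EF1 & EF2 & DF)].
    destruct IHG as [CG (G1 & G2 & EG1 & EG2 & DG)]. split.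
    + intros. apply continuity_2d_pt_plus; auto.
    + exists (fun x y => F1 x y + G1 x y), (fun x y => F2 x y + G2 x y).
      split; [now apply expr_plus|split; [now apply expr_plus|]]. intros x y Hx Hy.
      destruct (DF x y Hx Hy) as [? ?], (DG x y Hx Hy) as [? ?]. split.
      * now apply (is_derive_plus (fun u => F u y) (fun u => G u y)).
      * now apply (is_derive_plus (fun v => F x v) (fun v => G x v)).
  - destruct IHF as [CF (F1 & F2 & EF1 & EF2 & DF)].
    destruct IHG as [CG (G1 & G2 & EG1 & EG2 & DG)]. split.
    + intros. apply continuity_2d_pt_mult; auto.
    + exists (fun x y => F1 x y * G x y + F x y * G1 x y),
             (fun x y => F2 x y * G x y + F x y * G2 x y).
      assert (E : forall F' G', elliptic_expr F' -> elliptic_expr G' ->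
        elliptic_expr (fun x y => F' x y * G x y + F x y * G' x y)).
      { intros F' G' EF' EG'.
        apply (expr_plus (fun x y => F' x y * G x y) (fun x y => F x y * G' x y));
          now apply expr_mult. }
      split; [now apply E|split; [now apply E|]]. intros x y Hx Hy.
      destruct (DF x y Hx Hy) as [? ?], (DG x y Hx Hy) as [? ?]. split.
      * apply (is_derive_mult (fun u => F u y) (fun u => G u y)); trivial. exact Rmult_comm.
      * apply (is_derive_mult (fun v => F x v) (fun v => G x v)); trivial. exact Rmult_comm.
  - destruct IHF as [CF (F1 & F2 & EF1 & EF2 & DF)]. split.
    + intros. apply continuity_2d_pt_inv; auto.
    + assert (EI := expr_inv F NF HF).
      assert (E : forall H, elliptic_expr H ->
        elliptic_expr (fun x y => -1 * H x y * (/ F x y * / F x y))).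
      { intros H EH. apply (expr_mult (fun x y => -1 * H x y) (fun x y => / F x y * / F x y)).
        - now apply (expr_mult (fun _ _ => -1)); [apply expr_const|].
        - now apply (expr_mult (fun x y => / F x y) (fun x y => / F x y)). }
      exists (fun x y => -1 * F1 x y * (/ F x y * / F x y)),
             (fun x y => -1 * F2 x y * (/ F x y * / F x y)).
      split; [now apply E|split; [now apply E|]]. intros x y Hx Hy.
      destruct (DF x y Hx Hy) as [D1 D2]. specialize (NF x y Hx Hy).
      split.
      * evar_last; [now apply (is_derive_inv (fun u => F u y) x _ D1)|]. simpl. field. trivial.
      * evar_last; [now apply (is_derive_inv (fun v => F x v) y _ D2)|]. simpl. field. trivial.
Qed.

(** * The complete elliptic integral *)

Definition gauss (x y : R) : R := RInt (fun t => / sqrt (quad x y t)) 0 (PI / 2).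

Lemma gauss_elliptic x y : gauss x y = elliptic (fun _ => 1) 1 x y.
Proof. apply RInt_ext. intros t _. rewrite pow_1, Rmult_1_l. reflexivity. Qed.

Lemma continuous_gauss_integrand x y t :
  0 < x -> 0 < y -> continuous (fun t => / sqrt (quad x y t)) t.
Proof.
  intros Hx Hy.
  apply (continuous_comp (quad x y) (fun v => / sqrt v)); [apply continuous_quad|].
  apply continuous_ext with (fun u => (/ sqrt u) ^ 1); [intros; apply pow_1|].
  now apply continuous_inv_sqrt_pow, quad_pos.
Qed.

Lemma ex_RInt_gauss x y a b :
  0 < x -> 0 < y -> ex_RInt (fun t => / sqrt (quad x y t)) a b.
Proof.
  intros Hx Hy. apply (ex_RInt_continuous (V := R_CompleteNormedModule)). intros t _.
  now apply continuous_gauss_integrand.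
Qed.

Lemma gauss_sym x y : 0 < x -> 0 < y -> gauss x y = gauss y x.
Proof.
  intros Hx Hy. unfold gauss.
  generalize (RInt_comp_lin (V := R_CompleteNormedModule)
    (fun t => / sqrt (quad y x t)) (-1) (PI / 2) 0 (PI / 2)).
  replace (-1 * 0 + PI / 2) with (PI / 2) by ring.
  replace (-1 * (PI / 2) + PI / 2) with 0 by ring.
  intros H. 
  rewrite <- (opp_RInt_swap (V := R_CompleteNormedModule) (fun t => / sqrt (quad y x t)))
    by now apply ex_RInt_gauss.
  rewrite <- H by now apply ex_RInt_gauss.
  rewrite <- (RInt_opp (V := R_CompleteNormedModule)).
  - apply RInt_ext. intros t _. unfold quad.
    replace (-1 * t + PI / 2) with (PI / 2 - t) by ring.
    rewrite sin_shift, cos_shift, Rplus_comm.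
    unfold opp, scal; simpl; unfold mult; simpl. ring.
  - apply (ex_RInt_comp_lin (V := R_CompleteNormedModule) (fun t => / sqrt (quad y x t))).
    now apply ex_RInt_gauss.
Qed.

Lemma gauss_diag m : 0 < m -> gauss m m = PI / 2 * / sqrt m.
Proof.
  intros Hm. unfold gauss. rewrite (RInt_ext _ (fun _ => / sqrt m)).
  - rewrite RInt_const. unfold scal; simpl; unfold mult; simpl. ring.
  - intros t _. unfold quad. rewrite <- Rmult_plus_distr_l, sin2_plus_cos2, Rmult_1_r. reflexivity.
Qed.

Lemma gauss_bounds x y :
  0 < x -> 0 < y ->
  PI / 2 * / sqrt (Rmax x y) <= gauss x y <= PI / 2 * / sqrt (Rmin x y).
Proof.
  intros Hx Hy.
  assert (Hm : 0 < Rmin x y) by now apply Rmin_pos.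
  assert (HM : 0 < Rmax x y) by (generalize (Rmax_l x y); lra).
  assert (C1 : forall t : R, continuous (fun _ : R => 1) t) by (intros; apply continuous_const).
  rewrite <- !gauss_diag by trivial. rewrite !gauss_elliptic. split;
    apply elliptic_antitone; auto using Rmin_l, Rmin_r, Rmax_l, Rmax_r; intros; lra.
Qed.

Lemma gauss_pos x y : 0 < x -> 0 < y -> 0 < gauss x y.
Proof.
  intros Hx Hy. apply Rlt_le_trans with (2 := proj1 (gauss_bounds x y Hx Hy)).
  apply Rmult_lt_0_compat; [generalize PI_RGT_0; lra|].
  apply inv_sqrt_pos. generalize (Rmax_l x y); lra.
Qed.

(** A translation by [PI / 2] exchanges sine and cosine up to sign, so the second half of the
    interval contributes [gauss y x]. *)
Lemma RInt_0_PI_gauss x y :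
  0 < x -> 0 < y -> RInt (fun t => / sqrt (quad x y t)) 0 PI = 2 * gauss x y.
Proof.
  intros Hx Hy.
  rewrite <- (RInt_Chasles (V := R_CompleteNormedModule) _ 0 (PI / 2) PI) by
    now apply ex_RInt_gauss.
  fold (gauss x y).
  replace (RInt (fun t => / sqrt (quad x y t)) (PI / 2) PI) with (gauss y x).
  - rewrite (gauss_sym y x) by trivial. unfold plus; simpl. ring.
  - unfold gauss. generalize (RInt_comp_lin (V := R_CompleteNormedModule)
      (fun t => / sqrt (quad x y t)) 1 (PI / 2) 0 (PI / 2)).
    replace (1 * 0 + PI / 2) with (PI / 2) by ring.
    replace (1 * (PI / 2) + PI / 2) with PI by field.
    intros H. rewrite <- H by now apply ex_RInt_gauss.
    apply RInt_ext. intros t _. unfold quad.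
    replace (1 * t + PI / 2) with (PI / 2 + t) by ring.
    rewrite <- cos_sin. rewrite Rplus_comm.
    replace (cos (PI / 2 + t)) with (- sin t) by (rewrite sin_cos; ring).
    replace ((- sin t) ^ 2) with (sin t ^ 2) by ring.
    unfold scal; simpl; unfold mult; simpl. ring.
Qed.

(** * Landen's transformation *)

(** This is Landen's angle [t + atan ((b / a) tan t)], determined by
    [tan (landen a b t - t) = (b / a) tan t].  The subtraction formula for the tangent gives
    this form, in which nothing degenerates at [t = PI / 2], so that the change of variable
    can be done on the closed interval. *)
Definition landen (a b t : R) : R :=
  2 * t - atan ((a - b) * (sin t * cos t) / (a * cos t ^ 2 + b * sin t ^ 2)).

Lemma landen_denominator_sq a b t :
  (a * cos t ^ 2 + b * sin t ^ 2) ^ 2 + ((a - b) * (sin t * cos t)) ^ 2 =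
  quad (b ^ 2) (a ^ 2) t.
Proof.
  transitivity (quad (b ^ 2) (a ^ 2) t * (sin t ^ 2 + cos t ^ 2)).
  - unfold quad. ring.
  - rewrite sin2_plus_cos2. ring.
Qed.

Lemma is_derive_landen a b t :
  0 < a -> 0 < b ->
  is_derive (landen a b) t
    ((a + b) * (a * cos t ^ 2 + b * sin t ^ 2) / quad (b ^ 2) (a ^ 2) t).
Proof.
  intros Ha Hb.
  assert (Hm : 0 < a * cos t ^ 2 + b * sin t ^ 2).
  { generalize (quad_pos b a t Hb Ha). unfold quad. lra. }
  assert (HD : 0 < quad (b ^ 2) (a ^ 2) t) by (apply quad_pos; now apply pow_lt).
  assert (HE := landen_denominator_sq a b t).
  assert (Hz : is_derive
    (fun t => (a - b) * (sin t * cos t) / (a * cos t ^ 2 + b * sin t ^ 2)) t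
    ((a - b) * (a * cos t ^ 2 - b * sin t ^ 2) / (a * cos t ^ 2 + b * sin t ^ 2) ^ 2)).
  (* The numerator found by the quotient rule is homogeneous of degree 4. *)
  { replace (a * cos t ^ 2 - b * sin t ^ 2)
      with ((a * cos t ^ 2 - b * sin t ^ 2) * (sin t ^ 2 + cos t ^ 2))
      by (rewrite sin2_plus_cos2; ring).
    auto_derive; simpl in *; [lra|field; lra]. }
  set (m := a * cos t ^ 2 + b * sin t ^ 2) in *.
  set (D := quad (b ^ 2) (a ^ 2) t) in *.
  evar_last.
  - apply (is_derive_minus (K := R_AbsRing) (V := R_NormedModule) (fun t => 2 * t)
      (fun t => atan ((a - b) * (sin t * cos t) / (a * cos t ^ 2 + b * sin t ^ 2)))).
    + apply (is_derive_scal (fun t => t)), is_derive_id.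
    + apply (is_derive_comp atan); [|exact Hz]. apply is_derive_Reals, derivable_pt_lim_atan.
  - fold m. set (k := (a - b) * (a * cos t ^ 2 - b * sin t ^ 2)) in *.
    transitivity (2 - k / m ^ 2 * / (1 + ((a - b) * (sin t * cos t) / m) ^ 2)).
    { unfold minus, plus, opp, scal, one; simpl. unfold mult; simpl. unfold Rdiv. ring. }
    replace (1 + ((a - b) * (sin t * cos t) / m) ^ 2) with (D / m ^ 2)
      by (rewrite <- HE; field; lra).
    transitivity ((2 * D - k) / D); [field; lra|]. f_equal.
    replace k with (D - a * b * (sin t ^ 2 + cos t ^ 2)) by (unfold k, D, quad; ring).
    unfold D, m, quad. ring.
Qed.

Lemma landen_0 a b : landen a b 0 = 0.
Proof.
  unfold landen. rewrite sin_0, cos_0.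
  replace ((a - b) * (0 * 1) / (a * 1 ^ 2 + b * 0 ^ 2)) with 0 by (unfold Rdiv; ring).
  rewrite atan_0. ring.
Qed.

Lemma landen_PI2 a b : landen a b (PI / 2) = PI.
Proof.
  unfold landen. rewrite sin_PI2, cos_PI2.
  replace ((a - b) * (1 * 0) / (a * 0 ^ 2 + b * 1 ^ 2)) with 0 by (unfold Rdiv; ring).
  rewrite atan_0. field.
Qed.

(** With [D = quad (b^2) (a^2) t] the underlying formulas are
    [cos (landen a b t) = (a cos^2 t - b sin^2 t) / sqrt D] and
    [sin (landen a b t) = (a + b) sin t cos t / sqrt D]; only the squared cosine is computed,
    as a value of [quad] is determined by it. *)
Lemma cos_landen_sq a b t :
  0 < a -> 0 < b ->
  cos (landen a b t) ^ 2 =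
  (a * cos t ^ 2 - b * sin t ^ 2) ^ 2 / quad (b ^ 2) (a ^ 2) t.
Proof.
  intros Ha Hb.
  assert (Hm : 0 < a * cos t ^ 2 + b * sin t ^ 2).
  { generalize (quad_pos b a t Hb Ha). unfold quad. lra. }
  assert (HD : 0 < quad (b ^ 2) (a ^ 2) t) by (apply quad_pos; now apply pow_lt).
  unfold landen. rewrite cos_minus, cos_atan, sin_atan, cos_2a, sin_2a.
  set (m := a * cos t ^ 2 + b * sin t ^ 2) in *.
  set (D := quad (b ^ 2) (a ^ 2) t) in *.
  set (z := (a - b) * (sin t * cos t) / m).
  assert (HN : 1 + z² = D / m ^ 2).
  { unfold D. rewrite <- landen_denominator_sq. fold m. unfold z, Rsqr. field. lra. }
  rewrite HN.
  assert (HR : 0 < D / m ^ 2) by (apply Rdiv_lt_0_compat; [trivial|now apply pow_lt]).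
  assert (HS := sqrt_lt_R0 _ HR). assert (HS2 := pow2_sqrt _ (Rlt_le _ _ HR)).
  set (S := sqrt (D / m ^ 2)) in *.
  transitivity (((cos t * cos t - sin t * sin t) + 2 * sin t * cos t * z) ^ 2 / S ^ 2).
  { field. lra. }
  rewrite HS2. unfold z.
  transitivity (((cos t * cos t - sin t * sin t) * m
     + 2 * (a - b) * (sin t * cos t) ^ 2) ^ 2 / D).
  { field. lra. }
  f_equal. f_equal.
  (* Both sides agree as forms of degree 4 in the sine and cosine. *)
  transitivity ((a * cos t ^ 2 - b * sin t ^ 2) * (sin t ^ 2 + cos t ^ 2)).
  { unfold m. ring. }
  rewrite sin2_plus_cos2. ring.
Qed.

Lemma quad_landen a b t :
  0 < a -> 0 < b ->
  quad (a * b) (((a + b) / 2) ^ 2) (landen a b t) =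
  ((a + b) / 2 * (a * cos t ^ 2 + b * sin t ^ 2)) ^ 2 / quad (b ^ 2) (a ^ 2) t.
Proof.
  intros Ha Hb.
  assert (HD : 0 < quad (b ^ 2) (a ^ 2) t) by (apply quad_pos; now apply pow_lt).
  transitivity (a * b + ((a - b) / 2) ^ 2 * cos (landen a b t) ^ 2).
  { unfold quad. replace (sin (landen a b t) ^ 2) with (1 - cos (landen a b t) ^ 2)
      by (rewrite <- (sin2_plus_cos2 (landen a b t)); ring). field. }
  rewrite cos_landen_sq by trivial.
  assert (HE : quad (b ^ 2) (a ^ 2) t =
    (a * cos t ^ 2 + b * sin t ^ 2) ^ 2 + ((a - b) * (sin t * cos t)) ^ 2)
    by now rewrite landen_denominator_sq.
  set (D := quad (b ^ 2) (a ^ 2) t) in *.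
  transitivity ((a * b * D + ((a - b) / 2) ^ 2 * (a * cos t ^ 2 - b * sin t ^ 2) ^ 2) / D).
  { field. lra. }
  f_equal. rewrite HE.
  replace ((a * cos t ^ 2 - b * sin t ^ 2) ^ 2) with
    ((a * cos t ^ 2 + b * sin t ^ 2) ^ 2 - 4 * a * b * (sin t * cos t) ^ 2) by ring.
  field.
Qed.

(** The factor [a cos^2 t + b sin^2 t] appears both in the derivative of the substitution and
    in the square root of the new quadratic form, and cancels. *)
Lemma landen_integrand a b t :
  0 < a -> 0 < b ->
  (a + b) * (a * cos t ^ 2 + b * sin t ^ 2) / quad (b ^ 2) (a ^ 2) t *
    / sqrt (quad (a * b) (((a + b) / 2) ^ 2) (landen a b t)) =
  2 * / sqrt (quad (b ^ 2) (a ^ 2) t).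
Proof.
  intros Ha Hb.
  assert (Hm : 0 < a * cos t ^ 2 + b * sin t ^ 2).
  { generalize (quad_pos b a t Hb Ha). unfold quad. lra. }
  assert (HD : 0 < quad (b ^ 2) (a ^ 2) t) by (apply quad_pos; now apply pow_lt).
  rewrite quad_landen by trivial.
  set (m := a * cos t ^ 2 + b * sin t ^ 2) in *.
  set (D := quad (b ^ 2) (a ^ 2) t) in *.
  assert (HM : 0 < (a + b) / 2 * m) by (apply Rmult_lt_0_compat; lra).
  rewrite sqrt_div_alt, sqrt_pow2 by lra.
  assert (HS := sqrt_lt_R0 _ HD). assert (HS2 := pow2_sqrt _ (Rlt_le _ _ HD)).
  set (S := sqrt D) in *. rewrite <- HS2. field. lra.
Qed.

(** Invariance under one AGM step.  The symmetry of [gauss] puts both sides in the form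
    reached by [landen_integrand]; [landen a b] maps [[0, PI/2]] to [[0, PI]], and the
    factor 2 this produces cancels the one in [landen_integrand]. *)
Lemma gauss_landen a b :
  0 < a -> 0 < b -> gauss (((a + b) / 2) ^ 2) (a * b) = gauss (a ^ 2) (b ^ 2).
Proof.
  intros Ha Hb.
  assert (Ha2 := pow_lt a 2 Ha). assert (Hb2 := pow_lt b 2 Hb).
  assert (Hab := Rmult_lt_0_compat _ _ Ha Hb).
  assert (Hm : 0 < ((a + b) / 2) ^ 2) by (apply pow_lt; lra).
  rewrite gauss_sym, (gauss_sym (a ^ 2)) by trivial.
  apply Rmult_eq_reg_l with 2; [|lra]. rewrite <- RInt_0_PI_gauss by trivial.
  replace (RInt (fun t => / sqrt (quad (a * b) (((a + b) / 2) ^ 2) t)) 0 PI) with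
    (RInt (fun t => / sqrt (quad (a * b) (((a + b) / 2) ^ 2) t))
       (landen a b 0) (landen a b (PI / 2))) by now rewrite landen_0, landen_PI2.
  rewrite <- (RInt_comp (V := R_CompleteNormedModule) _ (landen a b)
    (fun t => (a + b) * (a * cos t ^ 2 + b * sin t ^ 2) / quad (b ^ 2) (a ^ 2) t)).
  - unfold gauss. rewrite <- (RInt_scal (V := R_CompleteNormedModule)) by
      now apply ex_RInt_gauss.
    apply RInt_ext. intros t _. now apply landen_integrand.
  - intros t _. now apply continuous_gauss_integrand.
  - intros t _. split; [now apply is_derive_landen|].
    apply (ex_derive_continuous (K := R_AbsRing) (V := R_NormedModule)).
    generalize (quad_pos _ _ t Hb2 Ha2). unfold quad. intros HD.
    auto_derive. simpl in *. lra.
Qed.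

(** * Gauss's theorem on the arithmetic-geometric mean *)

Lemma agm_seq_pos x y n :
  0 < x -> 0 < y -> 0 < fst (agm_seq x y n) /\ 0 < snd (agm_seq x y n).
Proof.
  intros Hx Hy. induction n as [|n IH]; [simpl; auto|].
  simpl. destruct (agm_seq x y n) as [a b]. simpl in *. destruct IH as [Ha Hb].
  split; [lra|]. apply sqrt_lt_R0. now apply Rmult_lt_0_compat.
Qed.

Lemma gauss_agm_seq x y n :
  0 < x -> 0 < y ->
  gauss (fst (agm_seq x y n) ^ 2) (snd (agm_seq x y n) ^ 2) = gauss (x ^ 2) (y ^ 2).
Proof.
  intros Hx Hy. induction n as [|n IH]; [reflexivity|].
  rewrite <- IH. generalize (agm_seq_pos x y n Hx Hy). simpl agm_seq.
  destruct (agm_seq x y n) as [a b]. simpl fst; simpl snd. intros [Ha Hb].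
  rewrite pow2_sqrt by (apply Rlt_le; now apply Rmult_lt_0_compat).
  now apply gauss_landen.
Qed.

(** The left side is [(sqrt a - sqrt b)^2 / 2] and
    [|a - b| = |sqrt a - sqrt b| (sqrt a + sqrt b)]. *)
Lemma amgm_gap a b :
  0 < a -> 0 < b -> Rabs ((a + b) / 2 - sqrt (a * b)) <= Rabs (a - b) / 2.
Proof.
  intros Ha Hb. rewrite sqrt_mult by lra.
  assert (Sa := sqrt_lt_R0 _ Ha). assert (Sb := sqrt_lt_R0 _ Hb).
  rewrite <- (pow2_sqrt a) at 1 3 by lra. rewrite <- (pow2_sqrt b) at 1 3 by lra.
  set (s := sqrt a) in *. set (t := sqrt b) in *.
  replace ((s ^ 2 + t ^ 2) / 2 - s * t) with ((s - t) ^ 2 / 2) by field.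
  rewrite Rabs_pos_eq by (generalize (pow2_ge_0 (s - t)); lra).
  unfold Rabs; destruct Rcase_abs; nra.
Qed.

Lemma agm_seq_gap x y n :
  0 < x -> 0 < y ->
  Rabs (fst (agm_seq x y n) - snd (agm_seq x y n)) <= Rabs (x - y) * (/ 2) ^ n.
Proof.
  intros Hx Hy. induction n as [|n IH]; [simpl; lra|].
  generalize (agm_seq_pos x y n Hx Hy). simpl agm_seq.
  destruct (agm_seq x y n) as [a b]. simpl in *. intros [Ha Hb].
  apply Rle_trans with (1 := amgm_gap a b Ha Hb). lra.
Qed.

Lemma gauss_sq_bounds a b :
  0 < a -> 0 < b -> Rmin a b <= PI / 2 / gauss (a ^ 2) (b ^ 2) <= Rmax a b.
Proof.
  intros Ha Hb.
  assert (Ha2 := pow_lt a 2 Ha). assert (Hb2 := pow_lt b 2 Hb).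
  assert (HG := gauss_pos _ _ Ha2 Hb2).
  assert (Hm : 0 < Rmin a b) by now apply Rmin_pos.
  assert (HM : 0 < Rmax a b) by (generalize (Rmax_l a b); lra).
  destruct (gauss_bounds _ _ Ha2 Hb2) as [B1 B2].
  assert (E1 : sqrt (Rmax (a ^ 2) (b ^ 2)) = Rmax a b).
  { apply sqrt_lem_1; [generalize (Rmax_l (a ^ 2) (b ^ 2)); lra|lra|].
    unfold Rmax. repeat destruct Rle_dec; nra. }
  assert (E2 : sqrt (Rmin (a ^ 2) (b ^ 2)) = Rmin a b).
  { apply sqrt_lem_1; [apply Rlt_le; now apply Rmin_pos|lra|].
    unfold Rmin. repeat destruct Rle_dec; nra. }
  rewrite E1 in B1. rewrite E2 in B2. split.
  - apply Rmult_le_reg_r with (gauss (a ^ 2) (b ^ 2) * / Rmin a b).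
    { apply Rmult_lt_0_compat; [trivial|now apply Rinv_0_lt_compat]. }
    replace (Rmin a b * (gauss (a ^ 2) (b ^ 2) * / Rmin a b))
      with (gauss (a ^ 2) (b ^ 2)) by (field; lra).
    replace (PI / 2 / gauss (a ^ 2) (b ^ 2) * (gauss (a ^ 2) (b ^ 2) * / Rmin a b))
      with (PI / 2 * / Rmin a b) by (field; lra). trivial.
  - apply Rmult_le_reg_r with (gauss (a ^ 2) (b ^ 2) * / Rmax a b).
    { apply Rmult_lt_0_compat; [trivial|now apply Rinv_0_lt_compat]. }
    replace (Rmax a b * (gauss (a ^ 2) (b ^ 2) * / Rmax a b))
      with (gauss (a ^ 2) (b ^ 2)) by (field; lra).
    replace (PI / 2 / gauss (a ^ 2) (b ^ 2) * (gauss (a ^ 2) (b ^ 2) * / Rmax a b))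
      with (PI / 2 * / Rmax a b) by (field; lra). trivial.
Qed.

Lemma is_lim_agm_seq x y :
  0 < x -> 0 < y ->
  is_lim_seq (fun n => fst (agm_seq x y n)) (PI / 2 / gauss (x ^ 2) (y ^ 2)) /\
  is_lim_seq (fun n => snd (agm_seq x y n)) (PI / 2 / gauss (x ^ 2) (y ^ 2)).
Proof.
  intros Hx Hy. set (l := PI / 2 / gauss (x ^ 2) (y ^ 2)).
  assert (HB : forall n, Rmin (fst (agm_seq x y n)) (snd (agm_seq x y n)) <= l <=
     Rmax (fst (agm_seq x y n)) (snd (agm_seq x y n))).
  { intros n. unfold l. rewrite <- (gauss_agm_seq x y n Hx Hy).
    destruct (agm_seq_pos x y n Hx Hy). now apply gauss_sq_bounds. }
  set (e := fun n => Rabs (x - y) * (/ 2) ^ n).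
  assert (He : is_lim_seq e 0).
  { replace (Finite 0) with (Rbar_mult (Rabs (x - y)) 0) by (simpl; f_equal; ring).
    apply is_lim_seq_scal_l, is_lim_seq_geom. rewrite Rabs_pos_eq; lra. }
  assert (Hl : is_lim_seq (fun n => l - e n) l).
  { replace (Finite l) with (Finite (l - 0)) by (f_equal; ring).
    apply is_lim_seq_minus'; [apply is_lim_seq_const|trivial]. }
  assert (Hr : is_lim_seq (fun n => l + e n) l).
  { replace (Finite l) with (Finite (l + 0)) by (f_equal; ring).
    apply is_lim_seq_plus'; [apply is_lim_seq_const|trivial]. }
  (* Two numbers with [l] between them are no farther from [l] than from each other. *)
  assert (HA : forall n, l - e n <= fst (agm_seq x y n) <= l + e n /\
                         l - e n <= snd (agm_seq x y n) <= l + e n).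
  { intros n. generalize (HB n) (agm_seq_gap x y n Hx Hy). fold (e n).
    unfold Rmin, Rmax, Rabs. repeat destruct Rle_dec; destruct Rcase_abs; lra. }
  split; apply is_lim_seq_le_le with (2 := Hl) (3 := Hr); intros n; apply HA.
Qed.

Lemma AGM_gauss x y : 0 < x -> 0 < y -> AGM x y = PI / 2 / gauss (x ^ 2) (y ^ 2).
Proof.
  intros Hx Hy. destruct (is_lim_agm_seq x y Hx Hy) as [L1 L2].
  assert (HA : is_lim_seq (fun n => fst (agm_seq x y n)) (AGM x y)).
  { refine (proj1 (epsilon_spec (inhabits 1) (fun l : R =>
      is_lim_seq (fun n => fst (agm_seq x y n)) l /\
      is_lim_seq (fun n => snd (agm_seq x y n)) l) _)).
    now exists (PI / 2 / gauss (x ^ 2) (y ^ 2)). }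
  apply is_lim_seq_unique in HA. apply is_lim_seq_unique in L1. congruence.
Qed.

(** * The arcsine integral *)

Lemma pos_inv_eq f z t :
  0 < t -> f t = z -> (forall s, 0 < s -> f s = z -> s = t) -> pos_inv f z = t.
Proof.
  intros Ht Hz Hu. unfold pos_inv.
  destruct (epsilon_spec (inhabits 1) (fun t => 0 < t /\ f t = z)) as [H1 H2]; eauto.
Qed.

Lemma pos_inv_inv_sqrt z : 0 < z -> pos_inv (fun t => 1 / sqrt t) z = / (z * z).
Proof.
  intros Hz. assert (Hz2 : 0 < z * z) by now apply Rmult_lt_0_compat.
  apply pos_inv_eq.
  - now apply Rinv_0_lt_compat.
  - rewrite sqrt_inv, sqrt_square by lra. field. lra.
  - intros s Hs <-. assert (0 < sqrt s) by now apply sqrt_lt_R0.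
    rewrite <- (sqrt_sqrt s) at 1 by lra. field. lra.
Qed.

Lemma pos_inv_sq z : 0 < z -> pos_inv (fun t => t ^ 2) (z ^ 2) = z.
Proof.
  intros Hz. apply pos_inv_eq; trivial. intros s Hs H. nra.
Qed.

Lemma continuous_asin_0 : continuous asin 0.
Proof.
  apply (ex_derive_continuous (K := R_AbsRing) (V := R_NormedModule)).
  apply ex_derive_Reals_1, derivable_pt_asin. lra.
Qed.

(** Moves the endpoint 1, where [asin] is not differentiable, to the endpoint 0. *)
Lemma asin_sqrt_1_minus t :
  0 < t < 1 -> asin (sqrt t) = PI / 2 - asin (sqrt (1 - t)).
Proof.
  intros Ht. assert (HR : 0 <= sqrt (1 - t) <= 1).
  { split; [apply sqrt_pos|]. rewrite <- sqrt_1 at 2. apply sqrt_le_1_alt. lra. }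
  rewrite <- (asin_sin (PI / 2 - asin (sqrt (1 - t)))).
  - f_equal. rewrite sin_shift, cos_asin by lra. unfold Rsqr. rewrite sqrt_sqrt by lra.
    f_equal. ring.
  - assert (0 <= asin (sqrt (1 - t)) <= PI / 2); [|lra]. split; [|apply asin_bound].
    destruct (Rle_or_lt 0 (asin (sqrt (1 - t)))) as [H|H]; [trivial|exfalso].
    assert (HS := sin_lt_0_var (asin (sqrt (1 - t)))). rewrite sin_asin in HS by lra.
    generalize (asin_bound (sqrt (1 - t))) PI_RGT_0. lra.
Qed.

Lemma filterlim_asin_sqrt_0 : filterlim (fun t => asin (sqrt t)) (at_right 0) (locally 0).
Proof.
  apply (filterlim_filter_le_1 (F := locally 0)); [apply filter_le_within|].
  assert (H : continuous (fun t => asin (sqrt t)) 0).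
  { apply (continuous_comp sqrt asin); [apply continuous_sqrt|].
    rewrite sqrt_0. apply continuous_asin_0. }
  unfold continuous in H. now rewrite sqrt_0, asin_0 in H.
Qed.

Lemma filterlim_asin_sqrt_1 :
  filterlim (fun t => asin (sqrt t)) (at_left 1) (locally (PI / 2)).
Proof.
  apply filterlim_ext_loc with (fun t => PI / 2 - asin (sqrt (1 - t))).
  { exists (mkposreal 1 Rlt_0_1). intros t Ht Ht1. symmetry. apply asin_sqrt_1_minus.
    apply Rabs_def2 in Ht. unfold minus, plus, opp in Ht; simpl in *. lra. }
  apply (filterlim_filter_le_1 (F := locally 1)); [apply filter_le_within|].
  assert (H : continuous (fun t => PI / 2 - asin (sqrt (1 - t))) 1).
  { apply (continuous_minus (V := R_NormedModule) (fun _ => PI / 2));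
      [apply continuous_const|].
    apply (continuous_comp (fun t => sqrt (1 - t)) asin).
    - apply continuous_sqrt_comp, (continuous_minus (V := R_NormedModule) (fun _ => 1));
        [apply continuous_const|apply continuous_id].
    - replace (sqrt (1 - 1)) with 0 by (rewrite <- sqrt_0; f_equal; ring).
      apply continuous_asin_0. }
  unfold continuous in H.
  replace (PI / 2 - asin (sqrt (1 - 1))) with (PI / 2) in H; trivial.
  replace (1 - 1) with 0 by ring. rewrite sqrt_0, asin_0. ring.
Qed.

Lemma is_derive_asin_sqrt t :
  0 < t < 1 -> is_derive (fun t => asin (sqrt t)) t (1 / (2 * sqrt (t * (1 - t)))).
Proof.
  intros Ht.
  assert (H0 := sqrt_lt_R0 t (proj1 Ht)).
  assert (H1 : 0 < sqrt (1 - t)) by (apply sqrt_lt_R0; lra).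
  assert (HR : -1 < sqrt t < 1).
  { split; [lra|]. rewrite <- sqrt_1. apply sqrt_lt_1_alt. lra. }
  evar_last.
  - apply (is_derive_comp asin sqrt).
    + apply is_derive_Reals. apply (derive_pt_eq_1 _ _ _ (derivable_pt_asin _ HR)).
      apply derive_pt_asin.
    + apply (is_derive_sqrt (fun t => t)); [apply is_derive_id|apply Ht].
  - unfold Rsqr. rewrite sqrt_sqrt, sqrt_mult by lra.
    unfold scal, one; simpl; unfold mult; simpl. field. lra.
Qed.

Lemma quad_asin_sqrt x y t :
  0 < t < 1 -> quad x y (asin (sqrt t)) = t * x + (1 - t) * y.
Proof.
  intros Ht.
  assert (HR : -1 <= sqrt t <= 1).
  { split; [generalize (sqrt_pos t); lra|]. rewrite <- sqrt_1. apply sqrt_le_1_alt. lra. }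
  unfold quad. rewrite sin_asin, cos_asin by trivial. unfold Rsqr.
  rewrite sqrt_sqrt, !pow2_sqrt by lra. ring.
Qed.

(** Substitution [t = sin^2 u], carried out on primitives: if [Phi] is a primitive of the
    integrand of [gauss], then [(2 / PI) Phi (asin (sqrt t))] is a primitive of the given one
    on (0,1), and it has limits at both ends although the integrand is unbounded there. *)
Lemma RInt_gen_arcsine x y :
  0 < x -> 0 < y ->
  RInt_gen (fun t => 1 / sqrt (t * x + (1 - t) * y) * (1 / (PI * sqrt (t * (1 - t)))))
    (at_right 0) (at_left 1) = 2 / PI * gauss x y.
Proof.
  intros Hx Hy. assert (HPI := PI_RGT_0).
  set (g := fun t => / sqrt (quad x y t)).
  set (Phi := fun u => RInt g 0 u).
  set (F := fun t => 2 / PI * Phi (asin (sqrt t))).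
  set (f := fun t => 1 / sqrt (t * x + (1 - t) * y) * (1 / (PI * sqrt (t * (1 - t))))).
  assert (HPhi : forall u, is_derive Phi u (g u)).
  { intros u. apply (is_derive_RInt g Phi 0 u).
    - apply filter_forall. intros v. apply (RInt_correct (V := R_CompleteNormedModule)).
      now apply ex_RInt_gauss.
    - now apply continuous_gauss_integrand. }
  assert (CPhi : forall u, continuous Phi u).
  { intros u. apply (ex_derive_continuous (K := R_AbsRing) (V := R_NormedModule)).
    eexists. apply HPhi. }
  assert (Hsq : forall t, 0 < t < 1 -> 0 < sqrt (t * (1 - t))).
  { intros t Ht. apply sqrt_lt_R0, Rmult_lt_0_compat; lra. }
  assert (Hav : forall t, 0 < t < 1 -> 0 < t * x + (1 - t) * y).
  { intros t Ht. rewrite <- quad_asin_sqrt by trivial. now apply quad_pos. }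
  assert (HF : forall t, 0 < t < 1 -> is_derive F t (f t)).
  { intros t Ht. evar_last.
    - apply is_derive_scal, (is_derive_comp Phi); [apply HPhi|now apply is_derive_asin_sqrt].
    - unfold g, f, scal; simpl; unfold mult; simpl. rewrite quad_asin_sqrt by trivial.
      specialize (Hsq t Ht). assert (HA := sqrt_lt_R0 _ (Hav t Ht)).
      field. lra. }
  assert (HD : forall t, 0 < t < 1 -> Derive F t = f t).
  { intros t Ht. now apply is_derive_unique, HF. }
  assert (Hab : filter_prod (at_right 0) (at_left 1) (fun ab => forall t,
     Rmin (fst ab) (snd ab) <= t <= Rmax (fst ab) (snd ab) -> 0 < t < 1)).
  { exists (fun a => 0 < a < 1) (fun b => 0 < b < 1).
    - exists (mkposreal 1 Rlt_0_1). intros a Ha Ha0.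
      apply Rabs_def2 in Ha. unfold minus, plus, opp in Ha; simpl in *. lra.
    - exists (mkposreal 1 Rlt_0_1). intros a Ha Ha0.
      apply Rabs_def2 in Ha. unfold minus, plus, opp in Ha; simpl in *. lra.
    - intros a b Ha Hb t. simpl. unfold Rmin, Rmax. destruct Rle_dec; lra. }
  apply is_RInt_gen_unique.
  apply (is_RInt_gen_ext (V := R_NormedModule) (Derive F)).
  { apply filter_imp with (2 := Hab). intros ab H t Ht. apply HD, H. lra. }
  replace (2 / PI * gauss x y) with (2 / PI * Phi (PI / 2) - 2 / PI * Phi 0).
  2: { unfold Phi. rewrite (RInt_point (V := R_CompleteNormedModule)).
       unfold zero, gauss; simpl. fold g. ring. }
  assert (HL : forall t0 (G : (R -> Prop) -> Prop),
    filterlim (fun t => asin (sqrt t)) G (locally t0) ->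
    filterlim F G (locally (2 / PI * Phi t0))).
  { intros t0 G HG.
    apply (filterlim_comp _ _ _ _ (fun u => 2 / PI * Phi u) _ _ _ HG).
    apply (continuous_mult (K := R_AbsRing) (fun _ => 2 / PI));
      [apply continuous_const|apply CPhi]. }
  apply is_RInt_gen_Derive.
  - apply filter_imp with (2 := Hab). intros ab H t Ht. eexists. apply HF, H, Ht.
  - apply filter_imp with (2 := Hab). intros ab H t Ht. specialize (H t Ht).
    apply continuous_ext_loc with f.
    + apply (locally_interval _ t 0 1); simpl; try apply H.
      intros u H0 H1. symmetry. now apply HD.
    + apply (ex_derive_continuous (K := R_AbsRing) (V := R_NormedModule)).
      specialize (Hsq t H). specialize (Hav t H). assert (HA := sqrt_lt_R0 _ Hav).
      assert (0 < t * (1 - t)) by (apply Rmult_lt_0_compat; lra).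
      unfold f, Rminus in *. auto_derive. repeat split; trivial; try lra.
      apply Rgt_not_eq. now apply Rmult_lt_0_compat.
  - apply HL, filterlim_asin_sqrt_0.
  - apply HL, filterlim_asin_sqrt_1.
Qed.

(** * The mean and the theorem *)

Lemma arcsine_mean_gauss x y :
  0 < x -> 0 < y ->
  weighted_integral_mean (fun t => 1 / sqrt t) (fun t => 1 / (PI * sqrt (t * (1 - t)))) x y =
  (PI / 2 / gauss x y) ^ 2.
Proof.
  intros Hx Hy. assert (HG := gauss_pos x y Hx Hy). assert (HPI := PI_RGT_0).
  unfold weighted_integral_mean. rewrite RInt_gen_arcsine by trivial.
  rewrite pos_inv_inv_sqrt.
  - field. lra.
  - apply Rmult_lt_0_compat; [|trivial]. apply Rdiv_lt_0_compat; lra.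
Qed.

Lemma arcsine_mean_is_mean :
  is_mean (weighted_integral_mean (fun t => 1 / sqrt t)
    (fun t => 1 / (PI * sqrt (t * (1 - t))))).
Proof.
  assert (HPI := PI_RGT_0). split; [|split].
  - set (I := elliptic (fun _ => 1) 1).
    assert (HI : elliptic_expr I).
    { apply expr_elliptic; intros t; [apply continuous_const|lra]. }
    apply pos_smooth_2d_of_closed with (C := elliptic_expr)
      (F := fun x y => (PI / 2) ^ 2 * / (I x y * I x y)).
    + exact elliptic_expr_closed.
    + apply (expr_mult (fun _ _ => (PI / 2) ^ 2)); [apply expr_const|].
      apply (expr_inv (fun x y => I x y * I x y)); [|now apply (expr_mult I I)].
      intros x y Hx Hy. unfold I. rewrite <- gauss_elliptic.
      generalize (gauss_pos x y Hx Hy). nra.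
    + intros x y Hx Hy. rewrite arcsine_mean_gauss by trivial.
      unfold I. rewrite <- gauss_elliptic. field. generalize (gauss_pos x y Hx Hy). lra.
  - intros x y Hx Hy. rewrite arcsine_mean_gauss by trivial.
    assert (Sx := sqrt_lt_R0 _ Hx). assert (Sy := sqrt_lt_R0 _ Hy).
    assert (Ex := pow2_sqrt x (Rlt_le _ _ Hx)). assert (Ey := pow2_sqrt y (Rlt_le _ _ Hy)).
    generalize (gauss_sq_bounds (sqrt x) (sqrt y) Sx Sy). rewrite Ex, Ey.
    generalize (PI / 2 / gauss x y). intros l Hl.
    generalize dependent (sqrt x). generalize dependent (sqrt y).
    intros s Hs Ey r Hr Ex Hl. subst x y. revert Hl.
    unfold Rmin, Rmax. repeat destruct Rle_dec; nra.
  - intros x y Hx Hy. rewrite !arcsine_mean_gauss, gauss_sym by trivial. reflexivity.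
Qed.

Theorem proposition4p8 :
  let f := fun t : R => 1 / sqrt t in
  let p := fun t : R => 1 / (PI * sqrt (t * (1 - t))) in
  let M := weighted_integral_mean f p in
  let h := fun t : R => t ^ 2 in
  is_M_mean M AGM /\
  (forall x y : R, 0 < x -> 0 < y -> AGM x y = conj_by h M x y).
Proof.
  intros f p M h.
  assert (E : forall x y : R, 0 < x -> 0 < y -> AGM x y = conj_by h M x y).
  { intros x y Hx Hy. unfold conj_by, M, f, p, h.
    assert (Hx2 := pow_lt x 2 Hx). assert (Hy2 := pow_lt y 2 Hy).
    rewrite arcsine_mean_gauss, pos_inv_sq by
      (trivial; generalize PI_RGT_0 (gauss_pos _ _ Hx2 Hy2); intros;
       apply Rdiv_lt_0_compat; lra).
    now apply AGM_gauss. }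
  split; [|exact E]. split; [exact arcsine_mean_is_mean|].
  exists h. repeat split; trivial.
  - intros x Hx. now apply pow_lt.
  - left. intros x y Hx Hxy. unfold h. nra.
  - intros n x _. apply ex_derive_n_pow.
Qed.
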